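(* For every integer $d \geq 1$, $b(d+1) \geq 2b(d) + 2$, where $b(d)$ is the maximum cardinality of a minimal edge cover of degree $d$ of a complete bipartite graph.
   Context: For a finite graph $G$, a family of subsets of $V(G)$ is an edge cover of $G$ iff every edge of $G$ is included in some member; it is a minimal edge cover iff no proper subfamily is an edge cover; it has degree $d$ if every vertex lies in at most $d$ members. *)

(* Defs.v *)
From mathcomp Require Import all_boot.
From mathcomp Require Import boolp.

Set Implicit Arguments.
Unset Strict Implicit.
Unset Printing Implicit Defensive.

(** A finite graph is given by a finite vertex type [T] and its adjacency
    relation [e : rel T]. *)

Section EdgeCovers.
Variables (T : finType) (e : rel T).
Implicit Types F : {set {set T}}.

Definition edge_cover F : Prop :=
  forall x y, e x y -> exists2 X, X \in F & [set x; y] \subset X.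

Definition minimal_edge_cover F : Prop :=
  edge_cover F /\ forall F', F' \proper F -> ~ edge_cover F'.

Definition has_degree F (d : nat) : Prop :=
  forall x, #|[set X in F | x \in X]| <= d.

(** [A] and its complement are the two parts. This makes [e] symmetric and
    irreflexive. A part may be empty; the graph then has no edge and its only
    minimal edge cover is the empty family, so this does not affect [b d] for
    [1 <= d] and gives [b 0 = 0]. *)
Definition complete_bipartite : Prop :=
  exists A : {set T}, forall x y, e x y = (x \in A) (+) (y \in A).

End EdgeCovers.

Definition cover_size (d k : nat) : Prop :=
  exists (T : finType) (e : rel T) (F : {set {set T}}),
    [/\ complete_bipartite e, minimal_edge_cover e F, has_degree F d
      & #|F| = k].

Lemma cover_size0 d : cover_size d 0.
Proof.
exists void, (fun _ _ => false), set0; split; last by rewrite cards0.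
- by exists set0; case.
- by split=> [[]|F']; rewrite // properE sub0set andbF.
- by case.
Qed.

(** The maximum defining [b d] exists: sizes of minimal edge covers of degree
    [d] are bounded. Each member [X] has a private edge [(a, b)]. Build a set
    [C] of members containing [a] greedily: as long as some vertex [b] of the
    other part lies in no member of [C], add a member containing [a] and [b]
    (at most [d] choices, at most [d] steps); when this stops, [X] is in [C]. *)
Fixpoint size_bound (d k : nat) : nat :=
  if k is k'.+1 then d * (size_bound d k').+1 else 0.

Section Bound.
Variables (T : finType) (e : rel T) (F : {set {set T}}) (d : nat).
Variable A : {set T}.
Hypothesis eA : forall x y, e x y = (x \in A) (+) (y \in A).
Hypothesis minF : minimal_edge_cover e F.
Hypothesis degF : has_degree F d.

Let S (x : T) := [set X in F | x \in X].
Let priv (X : {set T}) (a b : T) :=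
  [&& a \in A, b \notin A & S a :&: S b == [set X]].
Let P (C : {set {set T}}) :=
  [set X in F | [exists a, exists b, priv X a b && (C \subset S a)]].

Let cross a b : a \in A -> b \notin A -> exists Y, Y \in S a :&: S b.
Proof.
move=> aA bA; have [|X XF] := minF.1 a b; first by rewrite eA aA (negbTE bA).
rewrite subUset !sub1set => /andP[aX bX].
by exists X; rewrite !inE XF aX bX.
Qed.

Let privP X : X \in F -> exists a b, priv X a b.
Proof.
move=> XF; apply: contrapT => noP; apply: (minF.2 (F :\ X)).
  exact: properD1.
have main a b : a \in A -> b \notin A ->
    exists2 Y, Y \in F :\ X & [set a; b] \subset Y.
  move=> aA bA; have [Y Yab] := cross aA bA.
  case: (eqVneq (S a :&: S b) [set X]) => [E|neq].
    by case: noP; exists a, b; rewrite /priv aA bA E eqxx.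
  have [Z Zab ZX] : exists2 Z, Z \in S a :&: S b & Z != X.
    apply: contrapT => nZ; case/eqP: neq.
    have all Z : Z \in S a :&: S b -> Z = X.
      move=> h; apply/eqP; apply: contrapT => h'; apply: nZ.
      by exists Z => //; apply/negP.
    apply/setP => Z; rewrite [RHS]inE; apply/idP/eqP => [/all //|->].
    by rewrite -(all _ Yab).
  move: Zab; rewrite !inE => /andP[/andP[ZF aZ] /andP[_ bZ]].
  by exists Z; rewrite ?inE ?ZX // subUset !sub1set aZ.
move=> x y; rewrite eA; case xA: (x \in A) => /= yA; first exact: main.
have [|Y YF s] := main y x yA; first by rewrite xA.
by exists Y; rewrite // setUC.
Qed.

Let stop (C : {set {set T}}) :
  (forall y, y \notin A -> C :&: S y != set0) -> P C :\: C = set0.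
Proof.
move=> hitC; apply/setP => X; rewrite in_set0; apply/negP.
rewrite in_setD inE => /andP[XC /andP[_ /existsP[x /existsP[y]]]].
case/andP=> /and3P[_ yA /eqP Sxy] Cx.
have /set0Pn[Z] := hitC y yA; rewrite in_setI => /andP[ZC Zy].
have : Z \in S x :&: S y by rewrite in_setI (subsetP Cx) ?Zy.
by rewrite Sxy inE => /eqP ZX; rewrite -ZX ZC in XC.
Qed.

Let step (C : {set {set T}}) y X : y \notin A -> X \in P C ->
  exists2 Y, Y \in S y & X \in P (Y |: C) /\ exists x, Y |: C \subset S x.
Proof.
move=> yA; rewrite inE => /andP[XF /existsP[x /existsP[z /andP[pr Cx]]]].
have /and3P[xA _ _] := pr.
have [Y] := cross xA yA; rewrite in_setI => /andP[Yx Yy].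
have s : Y |: C \subset S x by rewrite subUset sub1set Yx.
exists Y => //; split; last by exists x.
by rewrite inE XF; apply/existsP; exists x; apply/existsP; exists z; rewrite pr.
Qed.

Let card_step (C : {set {set T}}) y Y :
  C :&: S y = set0 -> Y \in S y -> #|Y |: C| = #|C|.+1.
Proof.
move=> Cy Yy; rewrite cardsU1; case YC: (Y \in C) => //.
by have := in_setI Y C (S y); rewrite Cy YC Yy inE.
Qed.

Let bound k (C : {set {set T}}) : d <= #|C| + k ->
  #|P C :\: C| <= size_bound d k.
Proof.
elim: k C => [|k IH] C dC; have [hit|nohit] :=
    pselect (forall y, y \notin A -> C :&: S y != set0).
- by rewrite stop ?cards0.
- have [y [yA Cy]] : exists y, y \notin A /\ C :&: S y = set0.
    apply: contrapT => h; apply: nohit => y yA; apply/eqP => Cy.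
    by apply: h; exists y.
  rewrite leqn0 cards_eq0; apply/eqP/setP => X; rewrite in_set0.
  apply/negP; rewrite in_setD => /andP[_ /(step yA)[Y Yy [_ [x]]]].
  move/subset_leq_card; rewrite (card_step Cy Yy) => h.
  have := leq_trans h (degF x); rewrite addn0 in dC.
  by move=> h'; have := leq_trans h' dC; rewrite ltnn.
- by rewrite stop ?cards0.
have [y [yA Cy]] : exists y, y \notin A /\ C :&: S y = set0.
  apply: contrapT => h; apply: nohit => y yA; apply/eqP => Cy.
  by apply: h; exists y.
have sub : P C :\: C \subset
    \bigcup_(Y in S y) (Y |: (P (Y |: C) :\: (Y |: C))).
  apply/subsetP => X; rewrite in_setD => /andP[XC /(step yA)[Y Yy [XP _]]].
  apply/bigcupP; exists Y => //; rewrite in_setU1 in_setD in_setU1 XP.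
  by rewrite (negbTE XC) orbF andbT orbN.
apply: leq_trans (subset_leq_card sub) _.
apply: (@leq_trans (\sum_(Y in S y) #|Y |: (P (Y |: C) :\: (Y |: C))|)).
  apply: (big_ind2 (fun (U : {set {set T}}) n => #|U| <= n)) => //.
    by rewrite cards0.
  move=> U n V m Un Vm; apply: leq_trans (leq_add Un Vm).
  by rewrite cardsU leq_subr.
apply: (@leq_trans (\sum_(Y in S y) (size_bound d k).+1)).
  apply: leq_sum => Y Yy; rewrite cardsU1 -add1n; apply: leq_add.
    by case: (_ \notin _).
  by apply: IH; rewrite (card_step Cy Yy) addSnnS.
by rewrite sum_nat_const leq_mul2r (degF y) orbT.
Qed.

Lemma card_cover_bound : #|F| <= size_bound d d.
Proof.
have := @bound d set0; rewrite cards0 => /(_ (leqnn d)).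
apply: leq_trans; apply: subset_leq_card; apply/subsetP => X XF.
have [a [b pr]] := privP XF; rewrite in_setD !inE XF.
by apply/existsP; exists a; apply/existsP; exists b; rewrite pr sub0set.
Qed.

End Bound.

Lemma cover_size_bounded d k : cover_size d k -> k <= size_bound d d.
Proof. by move=> [T [e [F [[A eA] minF degF <-]]]]; exact: card_cover_bound. Qed.

Lemma exists_cover_size d : exists k, `[< cover_size d k >].
Proof. by exists 0; apply/asboolP; exact: cover_size0. Qed.

Lemma cover_size_le d k : `[< cover_size d k >] -> k <= size_bound d d.
Proof. by move/asboolP; exact: cover_size_bounded. Qed.

Definition b (d : nat) : nat :=
  ex_maxn (exists_cover_size d) (@cover_size_le d).

Lemma b_max d :
  cover_size d (b d) /\ forall k, cover_size d k -> k <= b d.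
Proof.
rewrite /b; case: ex_maxnP => m /asboolP mP mmax; split=> // k kP.
by apply: mmax; apply/asboolP.
Qed.

(* Main.v *)
Require Import Defs.
From mathcomp Require Import all_boot.
From mathcomp Require Import boolp.

Set Implicit Arguments.
Unset Strict Implicit.
Unset Printing Implicit Defensive.

(** Let [F] be a minimal edge cover of degree [d] of the complete bipartite
    graph with parts [A] and [B]. Take two disjoint copies [A0, B0] and
    [A1, B1] of the graph, with parts [A0 :|: A1] and [B0 :|: B1]. The copies of
    the members of [F] cover the edges inside a copy, and the two sets
    [A0 :|: B1] and [A1 :|: B0] cover the edges between the copies. Every vertex
    lies in exactly one of these two new sets, and no edge is covered both by a
    new set and by a copy, so private edges survive. *)

(** If each edge were also in a member other than [X], then [F :\ X] would still be an edge
    cover. *)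
Lemma minimal_edge_cover_private (T : finType) (e : rel T) (F : {set {set T}})
    (X : {set T}) :
  minimal_edge_cover e F -> X \in F ->
  exists x y, e x y /\ forall Y, Y \in F -> [set x; y] \subset Y -> Y = X.
Proof.
move=> [coverF minF] XF; apply: contrapT => noxy.
apply: (minF (F :\ X)); first exact: properD1.
move=> x y exy; apply: contrapT => noY; apply: noxy.
exists x, y; split=> // Y YF sxy; apply/eqP; apply: contrapT => /negP YX.
by apply: noY; exists Y; rewrite ?inE ?YX.
Qed.

(** Privacy is stated for indices rather than sets, so that private edges give both minimality and
    the injectivity needed to count the members. *)
Lemma private_minimal_edge_cover (T I : finType) (e : rel T) (D : {set I})
    (f : I -> {set T}) :
  edge_cover e (f @: D) ->
  (forall i, i \in D -> exists x y, e x y /\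
     forall j, j \in D -> [set x; y] \subset f j -> j = i) ->
  minimal_edge_cover e (f @: D) /\ {in D &, injective f}.
Proof.
move=> coverD privD; split; first split=> // F' /properP[sF' [_ /imsetP[i iD ->]]].
  move=> /negP niF' coverF'; have [x [y [exy priv]]] := privD i iD.
  have [Y YF' sxy] := coverF' x y exy.
  have /imsetP[j jD Yj] := subsetP sF' Y YF'.
  by apply: niF'; rewrite -(priv j jD) -?Yj.
(* The edge private to [i] lies in some [f k]; then [k = i], so it lies in [f i = f j] and
   [j = i]. *)
move=> i j iD jD fij; have [x [y [exy priv]]] := privD i iD.
have [_ /imsetP[k kD ->] sxy] := coverD x y exy.
by apply/esym/priv; rewrite // -fij -(priv k kD).
Qed.

Section Doubling.
Variables (T : finType) (A : {set T}).

Definition double_edge : rel (bool * T) :=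
  fun u v => (u.2 \in A) (+) (v.2 \in A).

(** With [false] and [true] as copies 0 and 1, [(true, None)] gives [A0 :|: B1] and [(false, None)]
    gives [A1 :|: B0]. *)
Definition double_member (u : bool * option {set T}) : {set bool * T} :=
  if u.2 is Some X then [set v | (v.1 == u.1) && (v.2 \in X)]
  else [set v | v.1 (+) (v.2 \in A) == u.1].

Definition double_index (F : {set {set T}}) : {set bool * option {set T}} :=
  setX [set: bool] (None |: Some @: F).

Lemma double_complete_bipartite : complete_bipartite double_edge.
Proof. by exists [set u | u.2 \in A] => u v; rewrite !inE. Qed.

Lemma in_double_index F i o :
  ((i, o) \in double_index F) = if o is Some X then X \in F else true.
Proof.
rewrite !inE /=; case: o => [X|] //=.
by rewrite mem_imset // => ? ? [].
Qed.

Lemma card_double_index F : #|double_index F| = 2 * #|F| + 2.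
Proof.
rewrite cardsX cardsT card_bool cardsU1 card_imset => [|? ? []//].
have -> : None \notin Some @: F by apply/imsetP => -[].
by rewrite mulnDr addnC.
Qed.

Variables (e : rel T) (F : {set {set T}}).
Hypothesis eA : forall x y, e x y = (x \in A) (+) (y \in A).
Hypothesis minF : minimal_edge_cover e F.

Lemma double_edge_cover :
  edge_cover double_edge (double_member @: double_index F).
Proof.
move=> [i x] [j y]; rewrite /double_edge /= => xy.
have [<-|ij] := eqVneq i j.
  have [|X XF] := minF.1 x y; first by rewrite eA.
  rewrite subUset !sub1set => /andP[xX yX].
  exists (double_member (i, Some X)).
    by apply: imset_f; rewrite in_double_index.
  by rewrite subUset !sub1set !inE /= eqxx xX yX.
(* Both the copy and the side change along this edge, so its ends have the same sum of copy bit and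
   side bit. *)
exists (double_member (i (+) (x \in A), None)).
  by apply: imset_f; rewrite in_double_index.
rewrite subUset !sub1set !inE /= eqxx /=.
by move: ij xy; case: i j (x \in A) (y \in A) => [] [] [] [].
Qed.

Lemma double_private u :
  F != set0 -> u \in double_index F ->
  exists x y, double_edge x y /\ forall v, v \in double_index F ->
    [set x; y] \subset double_member v -> v = u.
Proof.
move=> /set0Pn[X0 X0F]; case: u => i [X|]; rewrite in_double_index => uF.
  have [x [y [exy priv]]] := minimal_edge_cover_private minF uF.
  exists (i, x), (i, y); split; first by rewrite /double_edge -eA.
  case=> j [Y|]; rewrite in_double_index subUset !sub1set !inE /=.
    move=> YF /andP[/andP[/eqP-> xY] /andP[_ yY]].
    by rewrite (priv Y) // subUset !sub1set xY.
  (* The ends share a copy but not a side, so no new set contains both. *)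
  move: exy; rewrite eA.
  by case: i j (x \in A) (y \in A) => [] [] [] [].
(* Any edge of the original graph serves here. The copy bits put both ends into the new set [i], and
   in different copies since the sides differ. *)
have [x [y [exy _]]] := minimal_edge_cover_private minF X0F.
exists (i (+) (x \in A), x), (i (+) (y \in A), y).
move: exy; rewrite eA => exy; split=> //.
case=> j [Y|]; rewrite in_double_index subUset !sub1set !inE /=.
  by move: exy; case: i j (x \in A) (y \in A) => [] [] [] []; rewrite ?andbF.
by rewrite -addbA addbb addbF => _ /andP[/eqP-> _].
Qed.

Lemma double_has_degree d :
  has_degree F d -> has_degree (double_member @: double_index F) d.+1.
Proof.
move=> degF [i x].
(* Indices of the members through [(i, x)]: one new set and at most [d] copies. *)
pose C := (i (+) (x \in A), None) |:
  [set (i, Some X) | X in [set X in F | x \in X]].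
apply: (@leq_trans #|double_member @: C|).
  apply/subset_leq_card/subsetP => Z.
  rewrite inE => /andP[/imsetP[[j o]]]; rewrite in_double_index => oF -> xZ.
  apply: imset_f; case: o oF xZ => [X|] /= XF; rewrite !inE /=.
    move=> /andP[/eqP<- xX]; apply/orP; right.
    by apply/imsetP; exists X; rewrite ?inE ?XF.
  by move=> /eqP->; rewrite eqxx.
apply: leq_trans (leq_imset_card _ _) _.
rewrite cardsU1 -add1n; apply: leq_add; first by case: (_ \notin _).
by apply: leq_trans (leq_imset_card _ _) (degF x).
Qed.

End Doubling.

(** Positivity of [k] provides an edge, from which the new sets get their private edges. *)
Lemma cover_size_double d k :
  0 < k -> cover_size d k -> cover_size d.+1 (2 * k + 2).
Proof.
move=> k0 [T [e [F [[A eA] minF degF cardF]]]].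
have F0 : F != set0 by rewrite -card_gt0 cardF.
have [minD injD] := private_minimal_edge_cover (double_edge_cover eA minF)
  (fun u => double_private eA minF F0).
exists (bool * T)%type, (double_edge A), (double_member A @: double_index F).
split=> //; first exact: double_complete_bipartite.
- exact: double_has_degree.
- by rewrite card_in_imset // card_double_index cardF.
Qed.

(** A single edge covered by its vertex set; this makes [b d] positive, as doubling requires. *)
Lemma cover_size1 d : 0 < d -> cover_size d 1.
Proof.
move=> d0; exists bool, (fun x y => x (+) y), [set setT]; split.
- by exists [set true] => x y; rewrite !inE; case: x y => [] [].
- split=> [x y _|F' prF' coverF']; first by exists setT; rewrite ?inE.
  have [//|X] := coverF' true false.
  by move: prF'; rewrite properEcard cards1 ltnS leqn0 cards_eq0
    => /andP[_ /eqP->]; rewrite inE.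
- move=> x; apply: leq_trans d0; rewrite -(cards1 [set: bool]).
  by apply/subset_leq_card/subsetP => X; rewrite inE => /andP[].
- exact: cards1.
Qed.

Theorem theorem3p2 (d : nat) (hd : 1 <= d) : b (d + 1) >= 2 * b d + 2.
Proof.
have [bd maxd] := b_max d.
rewrite addn1; apply: (b_max d.+1).2.
by apply: cover_size_double bd; apply: maxd; apply: cover_size1.
Qed.
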